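(* Let $n \in \mathbb{N}$ and let $d, e \in \mathbb{N}$ with $e < d$ be fixed. Let $H_{RKHS}$ be a reproducing kernel Hilbert space of infinitely differentiable real-valued functions on $\mathbb{R}^n$ with kernel function $K$ and inner product $\langle \cdot,\cdot\rangle_{RKHS}$. For $g \in H_{RKHS}$ let $\mathcal{T}g := \phi_g : \mathcal{X} \to \mathcal{Y}$ be the canonical mapping $\phi_g[\gamma] := g(\gamma(\cdot))$. Then the space $$\mathcal{T}H_{RKHS} := \{\mathcal{T}g : g \in H_{RKHS}\},$$ equipped with the inner product $$\langle \phi, \psi\rangle_{OKHS} := \langle \mathcal{T}^{-1}\phi, \mathcal{T}^{-1}\psi\rangle_{RKHS},$$ where $\mathcal{T}^{-1}$ denotes the inverse of $\mathcal{T} : H_{RKHS} \to \mathcal{T}H_{RKHS}$, is an occupation kernel Hilbert space (OKHS) over $\mathcal{X}$ of order $q$ for every real $q > 0$.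
   Context: A (real-valued) reproducing kernel Hilbert space (RKHS) over a set $X$ is a Hilbert space $H$ of real-valued functions on $X$ such that for each $x \in X$ the evaluation functional $g \mapsto g(x)$ is bounded on $H$. By the Riesz representation theorem there is $k_x \in H$ with $\langle g, k_x\rangle_H = g(x)$ for all $g\in H$, and the kernel function is $K(x,y) = \langle k_y, k_x\rangle_H$. For fixed $d, e \in \mathbb{N}$ with $e < d$, the signal spaces are $$\mathcal{X} = \bigcup_{T>0} C^d([0,T],\mathbb{R}^n), \qquad \mathcal{Y} = \bigcup_{T>0} C^e([0,T],\mathbb{R}).$$ For $q > 0$ put $C_q := 1/\Gamma(q)$, where $\Gamma$ is Euler's Gamma function. Definition (OKHS). An occupation kernel Hilbert space (OKHS) of order $q$ over $\mathcal{X}$ is a Hilbert space $H$ consisting of functions $g : \mathcal{X} \to \mathcal{Y}$ such that for each $\gamma \in \mathcal{X}$, with $g[\gamma] : [0,T] \to \mathbb{R}$ denoting the image of $\gamma$ under $g$ in $\mathcal{Y}$, the functional $$g \mapsto C_q \int_0^{T} (T-t)^{q-1}\, g[\gamma](t)\, dt$$ is bounded on $H$. Canonical mapping. For an infinitely differentiable $g : \mathbb{R}^n \to \mathbb{R}$, $\phi_g : \mathcal{X} \to \mathcal{Y}$ is the map taking $\gamma \in \mathcal{X}$, $\gamma:[0,T]\to\mathbb{R}^n$, to the signal $\phi_g[\gamma] : [0,T] \to \mathbb{R}$, $\phi_g[\gamma](t) = g(\gamma(t))$, which is defined on the same interval $[0,T]$ as $\gamma$. The map $\mathcal{T}$ is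 given by $\mathcal{T}g := \phi_g$. The vector space operations on such maps are the standard pointwise ones: $(a\phi + b\psi)[\gamma](t) = a\,\phi[\gamma](t) + b\,\psi[\gamma](t)$. *)

(* Defs.v *)
From HB Require Import structures.
From mathcomp Require Import all_boot all_order all_algebra.
From mathcomp Require Import all_classical all_reals all_analysis.

Set Implicit Arguments.
Unset Strict Implicit.
Unset Printing Implicit Defensive.

Import Order.TTheory GRing.Theory Num.Theory.
Import numFieldNormedType.Exports.

Local Open Scope classical_set_scope.
Local Open Scope ring_scope.

Definition ip_norm (R : realType) (V : lmodType R) (ip : V -> V -> R) (u : V)
    : R :=
  Num.sqrt (ip u u).

(* The carrier is a set H of an ambient vector space V (below always a space of
   functions with pointwise operations); ip is only meaningful on H. *)
Definition inner_product_on (R : realType) (V : lmodType R) (H : set V)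
    (ip : V -> V -> R) : Prop :=
  [/\ forall u v, H u -> H v -> ip u v = ip v u,
      forall (a : R) u v w, H u -> H v -> H w ->
        ip (a *: u + v) w = a * ip u w + ip v w,
      forall u, H u -> 0 <= ip u u
    & forall u, H u -> ip u u = 0 -> u = 0].

Definition complete_on (R : realType) (V : lmodType R) (H : set V)
    (ip : V -> V -> R) : Prop :=
  forall u : nat -> V, (forall i, H (u i)) ->
    (forall eps : R, 0 < eps -> exists N, forall i j,
        (N <= i)%N -> (N <= j)%N -> ip_norm ip (u i - u j) < eps) ->
    exists2 l, H l & forall eps : R, 0 < eps -> exists N, forall i,
        (N <= i)%N -> ip_norm ip (u i - l) < eps.

Definition hilbert_space (R : realType) (V : lmodType R) (H : set V)
    (ip : V -> V -> R) : Prop :=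
  [/\ H 0,
      forall (a : R) u v, H u -> H v -> H (a *: u + v),
      inner_product_on H ip
    & complete_on H ip].

Definition bounded_functional (R : realType) (V : lmodType R) (H : set V)
    (ip : V -> V -> R) (F : V -> R) : Prop :=
  exists M : R, forall u, H u -> `|F u| <= M * ip_norm ip u.

Definition rkhs (R : realType) (X : Type) (H : set (X -> R))
    (ip : (X -> R) -> (X -> R) -> R) : Prop :=
  hilbert_space H ip /\
  forall x : X, bounded_functional H ip (fun g => g x).

Definition kernel_function (R : realType) (X : Type) (H : set (X -> R))
    (ip : (X -> R) -> (X -> R) -> R) (K : X -> X -> R) : Prop :=
  exists2 k : X -> X -> R,
    forall x, H (k x) /\ forall g, H g -> ip g (k x) = g x
  & forall x y, K x y = ip (k y) (k x).

(* f is k times (Frechet) differentiable: in finite dimension, f is k + 1 times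
   differentiable iff it is differentiable and all its directional derivatives
   are k times differentiable. *)
Fixpoint diff_times (R : realType) (n k : nat) (f : 'rV[R]_n -> R) : Prop :=
  if k is k'.+1 then
    (forall x, differentiable f x) /\ forall v, diff_times k' ('D_v f)
  else True.

Definition infinitely_differentiable (R : realType) (n : nat)
    (f : 'rV[R]_n -> R) : Prop :=
  forall k, diff_times k f.

(* f is C^k on [0, T]; limits are taken inside [0, T], so derivatives are
   one-sided at the end points and values of f outside [0, T] are irrelevant. *)
Fixpoint Ck_on (R : realType) (V : normedModType R) (k : nat) (T : R)
    (f : R -> V) : Prop :=
  if k is k'.+1 then
    exists2 f' : R -> V,
      forall t, t \in `[0, T] ->
        (s - t)^-1 *: (f s - f t) @[s --> within `[0, T] (t^')] --> f' t
    & Ck_on k' T f'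
  else {within `[0, T], continuous f}.

(* signal k V is the union over T > 0 of C^k([0, T], V). A function on [0, T]
   is encoded as its extension by 0 to R, so that equality of signals is
   equality of the intervals and of the functions on them. *)
Record signal (R : realType) (k : nat) (V : normedModType R) := Signal {
  dur : R;
  sigfun :> R -> V;
  dur_gt0 : 0 < dur;
  sig_Ck : Ck_on k dur sigfun;
  sig_out : forall t, t \notin `[0, dur] -> sigfun t = 0
}.

(* Maps from signals in R^n to scalar signals, sending a signal on [0, T] to a
   signal on the same [0, T]. They live in a space of curried functions, whose
   pointwise vector space structure is (a phi + b psi)[gamma](t) =
   a phi[gamma](t) + b psi[gamma](t). *)
Definition signal_maps (R : realType) (n d e : nat) :
    set (signal d 'rV[R]_n -> R -> R) :=
  [set phi | forall gamma, exists2 y : signal e R,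
     dur y = dur gamma & phi gamma = sigfun y].

Definition Gamma (R : realType) (q : R) : R :=
  \int[lebesgue_measure]_(x in `]0, +oo[) (x `^ (q - 1) * expR (- x)).

Definition occupation_functional (R : realType) (n d : nat) (q : R)
    (gamma : signal d 'rV[R]_n) (phi : signal d 'rV[R]_n -> R -> R) : R :=
  (Gamma q)^-1 * \int[lebesgue_measure]_(t in `[0, dur gamma])
    ((dur gamma - t) `^ (q - 1) * phi gamma t).

Definition okhs (R : realType) (n d e : nat) (q : R)
    (H : set (signal d 'rV[R]_n -> R -> R))
    (ip : (signal d 'rV[R]_n -> R -> R) -> (signal d 'rV[R]_n -> R -> R) -> R)
    : Prop :=
  [/\ H `<=` @signal_maps R n d e,
      hilbert_space H ip
    & forall gamma, bounded_functional H ip (occupation_functional q gamma)].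

Definition canonical_map (R : realType) (n d : nat) (g : 'rV[R]_n -> R) :
    signal d 'rV[R]_n -> R -> R :=
  fun gamma t => if t \in `[0, dur gamma] then g (gamma t) else 0.

Definition transported_ip (R : realType) (V W : lmodType R) (T : V -> W)
    (H : set V) (ip : V -> V -> R) : W -> W -> R :=
  fun phi psi => ip ('pinv_(fun=> 0) H T phi) ('pinv_(fun=> 0) H T psi).

(* Main.v *)
Require Import Defs.
From HB Require Import structures.
From mathcomp Require Import all_boot all_order all_algebra.
From mathcomp Require Import all_classical all_reals all_analysis.
From mathcomp Require Import measurable_realfun ring lra.
Import Order.TTheory GRing.Theory Num.Theory.
Import numFieldNormedType.Exports.
Local Open Scope classical_set_scope.
Local Open Scope ring_scope.

Set Implicit Arguments.
Unset Strict Implicit.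
Unset Printing Implicit Defensive.

(** Why the theorem holds.  Evaluating [phi_g] at a constant signal recovers the
value of [g] at any point, so the canonical map is injective (and it is linear);
transporting the inner product along an injective linear map carries the Hilbert
space structure to the image ([transported_hilbert_space]).  Two points need an
argument.

The images are signals of the right regularity.  By the chain rule, the derivative
of [g \o gamma] is a sum of products of [('D_v g) \o gamma] with coordinates of
the derivative of [gamma]; the functions [C^k] on [[0, T]] are stable under sums
and products, and the directional derivatives of [g] are again smooth, so an
induction on [k] shows that [g \o gamma] is as regular as [gamma]
([Ck_on_comp]).  Derivatives are one-sided at the end points, so this calculus is
carried out for limits inside [[0, T]].

The occupation functional is bounded.  Point evaluations are bounded one at a
time, whereas the integral over [t] calls for a bound that is uniform along
[gamma].  The reproducing property turns evaluation at [gamma t] into the inner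
product with the section of the kernel at [gamma t]; as [g \o gamma] is bounded
on the compact interval for each [g], these sections form a weakly bounded set,
and the uniform boundedness principle ([weakly_bounded_norm_bounded], where
completeness enters) bounds their norms
([rkhs_eval_uniform_bound]).  Hence [|g (gamma t)| <= M * |g|] for all [t] in
[[0, T]], and [M] times the integral of the weight [(T - t) `^ (q - 1)] bounds the
functional, up to the factor [(Gamma q)^-1].  That integral is finite for every [q > 0], even when the
weight is singular at [T] ([integrable_powR_subl]). *)

(** * Hilbert spaces carried by a subset of a vector space *)

Section HilbertSpace.
Context {R : realType} {V : lmodType R} {H : set V} {ip : V -> V -> R}.
Hypothesis hH : hilbert_space H ip.
Local Notation "`‖ u ‖" := (ip_norm ip u).

Let H0 : H 0. Proof. by case: hH. Qed.

Let HZD a u v : H u -> H v -> H (a *: u + v).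
Proof. by case: hH => _ + _ _; apply. Qed.

Lemma hilbertZ a u : H u -> H (a *: u).
Proof. by move=> Hu; rewrite -[a *: u]addr0; exact: HZD. Qed.

Lemma hilbertD u v : H u -> H v -> H (u + v).
Proof. by move=> Hu Hv; rewrite -[u]scale1r; exact: HZD. Qed.

Lemma hilbertB u v : H u -> H v -> H (u - v).
Proof. by move=> Hu Hv; rewrite addrC -scaleN1r; exact: HZD. Qed.

(* Lets // close the membership side conditions of the lemmas below. *)
#[local] Hint Extern 0 (H _) => solve
  [assumption | apply: hilbertZ; done | apply: hilbertB; done
   | apply: hilbertD; done] : core.

Lemma ipC u v : H u -> H v -> ip u v = ip v u.
Proof. by case: hH => _ _ [+ _ _ _] _; apply. Qed.

Lemma ip_ge0 u : H u -> 0 <= ip u u.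
Proof. by case: hH => _ _ [_ _ + _] _; apply. Qed.

Lemma ip_eq0 u : H u -> ip u u = 0 -> u = 0.
Proof. by case: hH => _ _ [_ _ _ +] _; apply. Qed.

Lemma ipZDl a u v w : H u -> H v -> H w -> ip (a *: u + v) w = a * ip u w + ip v w.
Proof. by case: hH => _ _ [_ + _ _] _; apply. Qed.

Lemma ipDl u v w : H u -> H v -> H w -> ip (u + v) w = ip u w + ip v w.
Proof. by move=> Hu Hv Hw; rewrite -[u]scale1r ipZDl// mul1r scale1r. Qed.

Lemma ip0l w : H w -> ip 0 w = 0.
Proof.
by move=> Hw; apply: (addrI (ip 0 w)); rewrite -ipDl// addr0 addr0.
Qed.

Lemma ipZl a u w : H u -> H w -> ip (a *: u) w = a * ip u w.
Proof. by move=> Hu Hw; rewrite -[a *: u]addr0 ipZDl// ip0l// addr0. Qed.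

Lemma ipBl u v w : H u -> H v -> H w -> ip (u - v) w = ip u w - ip v w.
Proof.
by move=> Hu Hv Hw; rewrite addrC -scaleN1r ipZDl// mulN1r addrC.
Qed.

Lemma ipDr u v w : H u -> H v -> H w -> ip w (u + v) = ip w u + ip w v.
Proof.
move=> Hu Hv Hw; have Huv := hilbertD Hu Hv.
by rewrite (ipC Hw Huv) ipDl// (ipC Hu)// (ipC Hv).
Qed.

Lemma ipZr a u w : H u -> H w -> ip w (a *: u) = a * ip w u.
Proof.
by move=> Hu Hw; have Hau := hilbertZ a Hu; rewrite (ipC Hw Hau) ipZl// (ipC Hu).
Qed.

Lemma ip_norm_ge0 u : 0 <= `‖u‖. Proof. exact: sqrtr_ge0. Qed.

Lemma sqr_ip_norm u : H u -> `‖u‖ ^+ 2 = ip u u.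
Proof. by move=> Hu; rewrite sqr_sqrtr// ip_ge0. Qed.

Lemma ip_normZ a u : H u -> `‖a *: u‖ = `|a| * `‖u‖.
Proof.
move=> Hu; rewrite /ip_norm ipZl// ipZr// mulrA -expr2.
by rewrite sqrtrM ?sqr_ge0// sqrtr_sqr.
Qed.

Lemma ip_normBC u v : H u -> H v -> `‖u - v‖ = `‖v - u‖.
Proof.
move=> Hu Hv; rewrite -[u - v]opprB -[- (v - u)]scaleN1r ip_normZ//.
by rewrite normrN1 mul1r.
Qed.

(** The nonnegative square norm of [u - c *: v], with [c *: v] the orthogonal
    projection of [u] on [v], is [ip u u - (ip u v) ^+ 2 / ip v v]. *)
Lemma cauchy_schwarz u v : H u -> H v -> `|ip u v| <= `‖u‖ * `‖v‖.
Proof.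
move=> Hu Hv; have [v0|v0] := eqVneq (ip v v) 0.
  by rewrite (ip_eq0 Hv v0) (ipC Hu)// ip0l// normr0 mulr_ge0// ip_norm_ge0.
have vv_gt0 : 0 < ip v v by rewrite lt_def v0 ip_ge0.
pose c := ip u v / ip v v.
have cvv : c * ip v v = ip u v by rewrite divfK.
have Hcv := hilbertZ (- c) Hv.
have := ip_ge0 (hilbertD Hu Hcv).
rewrite ipDl// !ipDr// !ipZr// !ipZl// (ipC Hv Hu) => h.
rewrite -ler_sqr ?nnegrE ?mulr_ge0 ?ip_norm_ge0// exprMn !sqr_ip_norm//.
rewrite real_normK ?num_real// -ler_pdivrMr//.
have -> : ip u v ^+ 2 / ip v v = c * ip u v by rewrite expr2 mulrAC.
have : c * (c * ip v v) = c * ip u v by rewrite cvv.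
lra.
Qed.

Lemma ip_normD u v : H u -> H v -> `‖u + v‖ <= `‖u‖ + `‖v‖.
Proof.
move=> Hu Hv.
rewrite -ler_sqr ?nnegrE ?addr_ge0 ?ip_norm_ge0// sqrrD !sqr_ip_norm//.
rewrite ipDl// ?ipDr// (ipC Hv Hu).
have := cauchy_schwarz Hu Hv; have := ler_norm (ip u v); lra.
Qed.

(** The uniform boundedness principle for the functionals [ip ^~ k], by a gliding
    hump instead of the Baire category theorem.  If the norms of [A] were
    unbounded, choose [k n] in [A] with norm beyond [2 * 3 ^+ n * n] and sum
    steps of length [3^-1 ^+ n] along [k n], with the sign that makes the pairing
    with [k n] large.  The later steps have total length at most half of the
    [n]-th one, so the limit still pairs with [k n] to more than [n]. *)
Lemma weakly_bounded_norm_bounded (A : set V) : A `<=` H ->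
  (forall u, H u -> exists M, forall k, A k -> `|ip u k| <= M) ->
  exists M, forall k, A k -> `‖k‖ <= M.
Proof.
move=> AH wbd; apply: contrapT => /forallNP unbounded.
have /choice[k kP] : forall n : nat,
    exists k, A k /\ 2 * 3 ^+ n * n%:R < `‖k‖.
  move=> n; have /existsNP[k /not_implyP[Ak /negP]] := unbounded (2 * 3 ^+ n * n%:R).
  by rewrite -ltNge => ?; exists k.
have Hk n : H (k n) by apply: AH; case: (kP n).
have nk_gt0 n : 0 < `‖k n‖.
  by case: (kP n) => _; apply: le_lt_trans; rewrite !mulr_ge0 ?exprn_ge0.
(* Choosing the sign of the step from the current pairing prevents any
   cancellation, whatever the earlier steps were. *)
pose sgn u n : R := if 0 <= ip u (k n) then 1 else -1.
pose h u n : V := (sgn u n * 3^-1 ^+ n * `‖k n‖^-1) *: k n.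
pose x := fix x n := if n is m.+1 then x m + h (x m) m else 0.
have Hh u n : H (h u n) by exact: hilbertZ.
have Hx n : H (x n) by elim: n => // n IH /=; exact: hilbertD.
have c_ge0 n : (0 : R) <= 3^-1 ^+ n by rewrite exprn_ge0// invr_ge0.
have nh u n : `‖h u n‖ = 3^-1 ^+ n.
  rewrite ip_normZ// !normrM (_ : `|sgn u n| = 1); last first.
    by rewrite /sgn; case: ifP; rewrite ?normrN1 ?normr1.
  rewrite mul1r ger0_norm// ger0_norm ?invr_ge0 ?ip_norm_ge0//.
  by field; rewrite gt_eqF.
have big n : 3^-1 ^+ n * `‖k n‖ <= `|ip (x n.+1) (k n)|.
  rewrite /= ipDl// ipZl// -sqr_ip_norm// /sgn.
  have -> s : s * 3^-1 ^+ n * `‖k n‖^-1 * `‖k n‖ ^+ 2 = s * (3^-1 ^+ n * `‖k n‖).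
    by field; rewrite gt_eqF.
  have := c_ge0 n; have := nk_gt0 n => k0 c0.
  have ck0 : 0 <= 3^-1 ^+ n * `‖k n‖ by rewrite mulr_ge0// ltW.
  case: ifPn; rewrite -?ltNge => ?.
    by rewrite mul1r ger0_norm ?addr_ge0// lerDr.
  by rewrite mulN1r ltr0_norm ?subr_lt0; lra.
(* 3 / 2 is the sum of the geometric series of ratio 1 / 3. *)
have close n j : `‖x (n + j)%N - x n‖ <= 3 / 2 * 3^-1 ^+ n.
  elim: j n => [|j IH] n.
    by rewrite addn0 subrr /ip_norm ip0l// sqrtr0 mulr_ge0.
  rewrite -addSnnS -(subrK (x n.+1) (x (n.+1 + j)%N)) -addrA.
  apply: le_trans (ip_normD _ _) _ => //.
  rewrite [x n.+1 - _]addrC /= addKr nh; have := IH n.+1; rewrite exprS.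
  by have := c_ge0 n; lra.
have small (e : R) : 0 < e -> exists N, 3 * 3^-1 ^+ N < e.
  move=> e0; exists (Num.bound (3 / e)); set N := Num.bound _.
  have h1 : 3 / e < N%:R by rewrite /N archi_boundP// divr_ge0// ltW.
  have h2 : N%:R <= 3 ^+ N :> R by rewrite -natrX ler_nat ltnW// ltn_expl.
  rewrite exprVn ltr_pdivrMr ?exprn_gt0// mulrC -ltr_pdivrMr//.
  exact: lt_le_trans h2.
have [_ _ _ cpl] := hH.
have [||l Hl lP] := cpl x => //.
  move=> e /small[N Ne]; exists N => i j Ni Nj; apply: le_lt_trans Ne.
  rewrite -(subrK (x N) (x i)) -addrA.
  apply: le_trans (ip_normD _ _) _ => //.
  rewrite (ip_normBC (Hx N) (Hx j)).
  have := close N (i - N)%N; have := close N (j - N)%N; rewrite !subnKC//.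
  have := c_ge0 N; lra.
have limclose n : `‖x n.+1 - l‖ <= 3^-1 ^+ n / 2.
  apply/ler_addgt0Pr => e /lP[N /(_ (N + n.+1)%N (leq_addr _ _)) Ne].
  rewrite -(subrK (x (N + n.+1)%N) (x n.+1)) -addrA.
  apply: le_trans (ip_normD _ _) _ => //.
  rewrite ip_normBC//; have := close n.+1 N; rewrite addnC exprS; lra.
have [M MP] := wbd l Hl.
pose n := Num.bound `|M|.
have Mn : `|M| < n%:R by exact: archi_boundP.
have [Akn kn] := kP n.
have := big n; have := MP _ Akn.
have -> : ip (x n.+1) (k n) = ip l (k n) + ip (x n.+1 - l) (k n).
  by rewrite -ipDl// addrC subrK.
have := ler_normD (ip l (k n)) (ip (x n.+1 - l) (k n)).
have := cauchy_schwarz (hilbertB (Hx n.+1) Hl) (Hk n).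
have : `‖x n.+1 - l‖ * `‖k n‖ <= 3^-1 ^+ n / 2 * `‖k n‖.
  by rewrite ler_wpM2r ?ip_norm_ge0.
have : n%:R < 3^-1 ^+ n / 2 * `‖k n‖.
  rewrite exprVn -invfM mulrC ltr_pdivlMr ?mulr_gt0 ?exprn_gt0//.
  by rewrite mulrC [_ * 2]mulrC.
have := ler_norm M; lra.
Qed.

End HilbertSpace.

Lemma transported_ipE (R : realType) (V W : lmodType R) (T : V -> W)
    (H : set V) (ip : V -> V -> R) (u v : V) : set_inj H T -> H u -> H v ->
  transported_ip T H ip (T u) (T v) = ip u v.
Proof.
by move=> injT Hu Hv; rewrite /transported_ip !pinvKV// inE.
Qed.

(** On the image of an injective [T] the partial inverse used by
    [transported_ip] is a true inverse, so [T] is an isometry and every axiom,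
    completeness included, can be pulled back to [H]. *)
Lemma transported_hilbert_space (R : realType) (V W : lmodType R)
    (T : {linear V -> W}) (H : set V) (ip : V -> V -> R) : set_inj H T ->
  hilbert_space H ip -> hilbert_space (T @` H) (transported_ip T H ip).
Proof.
move=> injT hH; have [H0 HZD [ipC ipZD ip_ge0 ip_eq0] cpl] := hH.
have tE := transported_ipE ip injT.
have tnB u v : H u -> H v ->
    ip_norm (transported_ip T H ip) (T u - T v) = ip_norm ip (u - v).
  by move=> Hu Hv; rewrite /ip_norm -linearB tE//; exact: (hilbertB hH).
split.
- by exists 0; rewrite ?linear0.
- by move=> a _ _ [u Hu <-] [v Hv <-]; exists (a *: u + v); [exact: HZD|rewrite linearP].
- split.
  + by move=> _ _ [u Hu <-] [v Hv <-]; rewrite !tE// ipC.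
  + move=> a _ _ _ [u Hu <-] [v Hv <-] [w Hw <-].
    by rewrite -linearP !tE ?ipZD//; exact: HZD.
  + by move=> _ [u Hu <-]; rewrite tE// ip_ge0.
  + by move=> _ [u Hu <-]; rewrite tE// => /(ip_eq0 _ Hu) ->; rewrite linear0.
- move=> y yP cauchy.
  have /choice[x xP] : forall n, exists x, H x /\ T x = y n.
    by move=> n; have [x] := yP n; exists x.
  have [Hx Tx] : (forall n, H (x n)) /\ y = T \o x.
    by split=> [n|]; [case: (xP n)|apply/funext => n /=; case: (xP n)].
  have [||l Hl lP] := cpl x => //.
    move=> e /cauchy[N NP]; exists N => i j Ni Nj.
    by have := NP i j Ni Nj; rewrite Tx tnB.
  exists (T l); first by exists l.
  move=> e /lP[N NP]; exists N => i Ni.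
  by rewrite Tx tnB//; exact: NP.
Qed.

(** * Functions of class C^k on a closed interval *)

Section CkOn.
Context {R : realType}.
Implicit Types (V : normedModType R) (T t : R) (k : nat).

(** Difference quotients live on punctured neighbourhoods, continuity on full
    ones; the missing point is harmless when the limit is the value. *)
Lemma cvg_within_dnbhs V (A : set R) t (f : R -> V) :
  f @ within A t^' --> f t -> f @ within A (nbhs t) --> f t.
Proof.
move=> ft U Ut.
have sU : \forall s \near t, s != t -> A s -> U (f s) := ft U Ut.
suff : \forall s \near t, A s -> U (f s) by [].
near=> s => As; have [->|st] := eqVneq s t.
  exact: nbhs_singleton.
by move: As; move: st; near: s.
Unshelve. all: by end_near. Qed.

Lemma near_within_dnbhs (A : set R) t :
  \forall s \near within A t^', s != t /\ A s.
Proof.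
suff : \forall s \near t, s != t -> A s -> s != t /\ A s by [].
by near=> s.
Unshelve. all: by end_near. Qed.

Lemma diff_quotient_cvg V T (f : R -> V) (l : V) t :
  (s - t)^-1 *: (f s - f t) @[s --> within `[0, T] t^'] --> l ->
  f s @[s --> within `[0, T] t^'] --> f t.
Proof.
move=> fl.
have st0 : s - t @[s --> within `[0, T] t^'] --> (0 : R).
  have h : s - t @[s --> t] --> (0 : R).
    rewrite -[X in _ --> X](subrr t).
    by apply: cvgB; [exact: cvg_id|exact: cvg_cst].
  apply: (cvg_trans _ h); apply: cvg_app => U tU.
  suff : \forall s \near t, s != t -> `[0, T]%classic s -> U s by [].
  by near=> s => _ _; near: s.
have h : f t + (s - t) *: ((s - t)^-1 *: (f s - f t))
    @[s --> within `[0, T] t^'] --> f t + 0 *: l.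
  by apply: cvgD; [exact: cvg_cst|exact: cvgZ].
rewrite scale0r addr0 in h; apply: (cvg_trans _ h); apply: near_eq_cvg.
near=> s; have [st _] : s != t /\ `[0, T]%classic s.
  by near: s; exact: near_within_dnbhs.
by rewrite scalerA divff ?subr_eq0// scale1r addrC subrK.
Unshelve. all: by end_near. Qed.

(** Stated for every [k], since [Ck_on k.+1] does not contain a continuity
    clause: it comes from differentiability. *)
Lemma Ck_on_continuous V k T (f : R -> V) :
  Ck_on k T f -> {within `[0, T], continuous f}.
Proof.
case: k => // k [f' ff' _]; apply/subspace_continuousP => t tT.
exact/cvg_within_dnbhs/diff_quotient_cvg/ff'.
Qed.

Lemma Ck_onS V k T (f : R -> V) : Ck_on k.+1 T f -> Ck_on k T f.
Proof.
elim: k f => [|k IH] f; first exact: Ck_on_continuous.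
by move=> [f' ff' /IH ?]; exists f'.
Qed.

Lemma Ck_on_le V k m T (f : R -> V) : (k <= m)%N -> Ck_on m T f -> Ck_on k T f.
Proof. by move=> /subnK <-; elim: (m - k)%N => // i IH /Ck_onS. Qed.

(** Signals are extended by 0 outside [[0, T]], which generally breaks their
    regularity on the line; this lemma exchanges such an extension for a formula
    valid on all of it. *)
Lemma eq_Ck_on V k T (f g : R -> V) : (forall t, t \in `[0, T] -> f t = g t) ->
  Ck_on k T f -> Ck_on k T g.
Proof.
case: k => [|k] fg /=.
  by apply: subspace_eq_continuous => t; rewrite inE => /fg.
move=> [f' ff' kf']; exists f' => // t tT.
apply: (cvg_trans _ (ff' t tT)); apply: near_eq_cvg.
near=> s; have [_ sT] : s != t /\ `[0, T]%classic s.
  by near: s; exact: near_within_dnbhs.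
by rewrite /= !fg.
Unshelve. all: by end_near. Qed.

Lemma Ck_on_cst V k T (v : V) : Ck_on k T (fun=> v).
Proof.
elim: k v => [|k IH] v /=; first by move=> t; exact: cvg_cst.
exists (fun=> 0) => // t _; under eq_fun do rewrite subrr scaler0.
exact: cvg_cst.
Qed.

Lemma Ck_onD V k T (f g : R -> V) :
  Ck_on k T f -> Ck_on k T g -> Ck_on k T (f \+ g).
Proof.
elim: k f g => [|k IH] f g /=.
  by move=> cf cg t; apply: cvgD; [exact: cf|exact: cg].
move=> [f' ff' kf'] [g' gg' kg']; exists (f' \+ g'); last exact: IH.
move=> t tT; have h : (s - t)^-1 *: (f s - f t) + (s - t)^-1 *: (g s - g t)
    @[s --> within `[0, T] t^'] --> f' t + g' t.
  by apply: cvgD; [exact: ff'|exact: gg'].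
apply: (cvg_trans _ h).
apply: near_eq_cvg; near=> s; rewrite /= -scalerDr; congr (_ *: _).
by rewrite opprD addrACA.
Unshelve. all: by end_near. Qed.

Lemma Ck_on_sum V (I : Type) (r : seq I) k T (F : I -> R -> V) :
  (forall i, Ck_on k T (F i)) -> Ck_on k T (fun t => \sum_(i <- r) F i t).
Proof.
move=> kF; elim: r => [|i r IH].
  by apply: eq_Ck_on (Ck_on_cst k T 0) => t _; rewrite big_nil.
by apply: eq_Ck_on (Ck_onD (kF i) IH) => t _; rewrite big_cons.
Qed.

Lemma Ck_onM k T (f g : R -> R) :
  Ck_on k T f -> Ck_on k T g -> Ck_on k T (f \* g).
Proof.
elim: k f g => [|k IH] f g.
  by move=> cf cg t; apply: cvgM; [exact: cf|exact: cg].
move=> kf kg; have [f' ff' kf'] := kf; have [g' gg' kg'] := kg.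
exists ((f' \* g) \+ (f \* g')).
  move=> t tT; have gt := diff_quotient_cvg (gg' t tT).
  have h : (s - t)^-1 *: (f s - f t) * g s + f t * ((s - t)^-1 *: (g s - g t))
      @[s --> within `[0, T] t^'] --> f' t * g t + f t * g' t.
    apply: cvgD; apply: cvgM; [exact: ff'|exact: gt|exact: cvg_cst|exact: gg'].
  apply: (cvg_trans _ h); apply: near_eq_cvg; near=> s => /=.
  rewrite /GRing.scale/=; ring.
by apply: Ck_onD; apply: IH => //; exact: Ck_onS.
Unshelve. all: by end_near. Qed.

Lemma Ck_on_coord n k T (f : R -> 'rV[R]_n) j :
  Ck_on k T f -> Ck_on k T (fun t => f t ord0 j).
Proof.
elim: k f => [|k IH] f /=.
  move=> cf t; have fj := @coord_continuous _ _ _ ord0 j (f t).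
  exact: (cvg_comp f (fun v => v ord0 j) (cf t) fj).
move=> [f' ff' kf']; exists (fun t => f' t ord0 j); last exact: IH.
move=> t tT.
have h : ((s - t)^-1 *: (f s - f t)) ord0 j
    @[s --> within `[0, T] t^'] --> f' t ord0 j.
  have fj := @coord_continuous _ _ _ ord0 j (f' t).
  exact: (cvg_comp _ (fun v => v ord0 j) (ff' t tT) fj).
by apply: (cvg_trans _ h); apply: near_eq_cvg; near=> s; rewrite /= !mxE.
Unshelve. all: by end_near. Qed.

(** Chain rule along the filter of points of [[0, T]] other than [t].  The
    difference quotient of [g \o f] is ['d g (f t)] applied to that of [f], plus
    the remainder of the first-order expansion of [g] divided by [s - t]; the
    latter vanishes because the quotient of [f] is eventually bounded by
    [|l| + 1]. *)
Lemma diff_quotient_comp V T (f : R -> V) (g : V -> R) (l : V) t :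
  differentiable g (f t) ->
  (s - t)^-1 *: (f s - f t) @[s --> within `[0, T] t^'] --> l ->
  (s - t)^-1 *: (g (f s) - g (f t)) @[s --> within `[0, T] t^'] --> 'd g (f t) l.
Proof.
move=> dg fl; have ft := diff_quotient_cvg fl.
have [dgc gE] := (diff_locallyP _ _).1 dg.
set o := 'o _ in gE.
have o0 : (s - t)^-1 *: (o : V -> R) (f s - f t) @[s --> within `[0, T] t^'] --> (0 : R).
  apply/cvgr0Pnorm_le => e e0.
  have B0 : 0 < `|l| + 1 by rewrite ltr_wpDl.
  have eB : 0 < e / (`|l| + 1) by rewrite divr_gt0.
  have fB : \forall s \near within `[0, T] t^',
      `|(s - t)^-1 *: (f s - f t)| <= `|l| + 1.
    by apply: (cvgr_norm_le l fl); rewrite ltrDl.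
  have fo : \forall s \near within `[0, T] t^',
      `|(o : V -> R) (f s - f t)| <= e / (`|l| + 1) * `|f s - f t|.
    have := littleoP o eB.
    have : f s - f t @[s --> within `[0, T] t^'] --> 0.
      by rewrite -(subrr (f t)); apply: cvgB => //; exact: cvg_cst.
    exact.
  near=> s.
  rewrite normrZ.
  apply: (@le_trans _ _ (`|(s - t)^-1| * (e / (`|l| + 1) * `|f s - f t|))).
    by rewrite ler_wpM2l//; near: s.
  rewrite mulrCA -normrZ mulrAC ler_pdivrMr// ler_wpM2l ?(ltW e0)//.
  by near: s.
have h : 'd g (f t) ((s - t)^-1 *: (f s - f t)) +
      (s - t)^-1 *: (o : V -> R) (f s - f t)
    @[s --> within `[0, T] t^'] --> 'd g (f t) l + 0.
  by apply: cvgD => //; exact: (cvg_comp _ _ fl (dgc l)).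
rewrite addr0 in h; apply: (cvg_trans _ h); apply: near_eq_cvg; near=> s => /=.
have := congr1 (fun h => h (f s - f t)) gE.
rewrite /= subrK => ->; rewrite linearZ -scalerDr; congr (_ *: _).
rewrite !fctE; ring.
Unshelve. all: by end_near. Qed.

Lemma infinitely_differentiable_derive n (g : 'rV[R]_n -> R) v :
  infinitely_differentiable g -> infinitely_differentiable ('D_v g).
Proof. by move=> sg k; have [_ /(_ v)] := sg k.+1. Qed.

(** Expanding the derivative of [g \o f] in the canonical basis expresses it
    through compositions of smooth functions with [f] and coordinates of [f'], to
    which the induction hypothesis and the closure under products apply. *)
Lemma Ck_on_comp n k T (f : R -> 'rV[R]_n) (g : 'rV[R]_n -> R) :
  infinitely_differentiable g -> Ck_on k T f -> Ck_on k T (g \o f).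
Proof.
elim: k f g => [|k IH] f g sg; have [dg _] := sg 1%N.
  move=> cf t; have gf := differentiable_continuous (dg (f t)).
  exact: (cvg_comp f g (cf t) gf).
move=> kf; have [f' ff' kf'] := kf.
pose e j : 'rV[R]_n := delta_mx ord0 j.
exists (fun t => \sum_j 'D_(e j) g (f t) * f' t ord0 j).
  move=> t tT.
  have -> : \sum_j 'D_(e j) g (f t) * f' t ord0 j = 'd g (f t) (f' t).
    rewrite [in RHS](row_sum_delta (f' t)) linear_sum; apply: eq_bigr => j _.
    by rewrite linearZ deriveE// mulrC.
  by apply: diff_quotient_comp => //; exact: ff'.
apply: Ck_on_sum => j; apply: Ck_onM; last exact: Ck_on_coord.
by apply: (IH f ('D_(e j) g)); [exact: infinitely_differentiable_derive|exact: Ck_onS].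
Qed.

End CkOn.

(** * Integrability of the weight of the occupation functional *)

Section Weight.
Context {R : realType}.
Local Notation mu := (@lebesgue_measure R).

Lemma is_derive_powR_subl (T a s : R) : s < T ->
  is_derive s 1 (fun t => (T - t) `^ a) (- (a * (T - s) `^ (a - 1))).
Proof.
move=> sT; have Ts : 0 < T - s by rewrite subr_gt0.
have -> : (fun t => (T - t) `^ a) = (fun x => x `^ a) \o (fun t => T - t) by [].
have d1 := is_derive1_powR a Ts.
apply: is_derive_eq.
by rewrite add0r mul1r mulrN1.
Qed.

Lemma continuous_powR_subl (T a s : R) : s < T ->
  {for s, continuous (fun t => (T - t) `^ a)}.
Proof.
move=> sT; apply/differentiable_continuous/derivable1_diffP.
by have [] := is_derive_powR_subl a sT.
Qed.

(** Away from the singularity at [T] the weight has the primitive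
    [- q^-1 * (T - t) `^ q], which is nonpositive; dropping its value at [b] gives
    a bound independent of [b]. *)
Lemma integral_powR_subl_le (T q b : R) : 0 < q -> 0 < b -> b < T ->
  (\int[mu]_(t in `[0%R, b]) ((T - t) `^ (q - 1))%:E <= (T `^ q / q)%:E)%E.
Proof.
move=> q0 b0 bT.
pose F t := - q^-1 * (T - t) `^ q.
have dF s : s < T -> is_derive s 1 F ((T - s) `^ (q - 1)).
  move=> sT; have := is_derive_powR_subl q sT => ?.
  apply: is_derive_eq; rewrite /GRing.scale/= mulrNN mulrA mulVf ?mul1r//.
  by rewrite gt_eqF.
have cF s : s < T -> {for s, continuous F}.
  move=> sT; apply/differentiable_continuous/derivable1_diffP.
  by have [] := dF _ sT.
rewrite (@continuous_FTC2 _ _ F)//.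
- rewrite -EFinB lee_fin /F subr0 !mulNr opprK addrC mulrC gerBl.
  by rewrite mulr_ge0 ?powR_ge0// invr_ge0 ltW.
- apply: continuous_in_subspaceT => s; rewrite inE/= in_itv/= => /andP[_ sb].
  exact/continuous_powR_subl/(le_lt_trans sb).
- split.
  + move=> s; rewrite in_itv/= => /andP[_ sb].
    by have [] := dF s (lt_trans sb bT).
  + by apply: cvg_at_right_filter; apply: cF; exact: lt_trans bT.
  + by apply: cvg_at_left_filter; exact: cF.
- move=> s; rewrite in_itv/= => /andP[_ sb].
  by rewrite derive1E; have [_ ->] := dF s (lt_trans sb bT).
Qed.

Lemma measurable_powR_subl (T a : R) (D : set R) : measurable D ->
  measurable_fun D (fun t => (T - t) `^ a).
Proof.
move=> mD; apply: (@measurableT_comp _ _ _ _ _ _ (fun x => x `^ a)).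
  exact: measurable_powR.
exact: measurable_funB.
Qed.

(** Monotone convergence along intervals exhausting [[0, T[], on each of which the
    weight is continuous. *)
Lemma integrable_powR_subl (T q : R) : 0 < q -> 0 < T ->
  mu.-integrable `[0, T] (fun t => ((T - t) `^ (q - 1))%:E).
Proof.
move=> q0 T0; set w := fun t : R => _%:E.
have w0 t : (0 <= w t)%E by rewrite lee_fin powR_ge0.
have mw D : measurable D -> measurable_fun D w.
  by move=> mD; apply/measurable_EFinP; exact: measurable_powR_subl.
apply/integrableP; split; first exact: mw.
under eq_integral do rewrite gee0_abs//.
apply: (@le_lt_trans _ _ (T `^ q / q)%:E); last exact: ltry.
(* The denominators start at 2 so that [0, b 0] is not reduced to a point. *)
pose b (i : nat) := T - T / i.+2%:R.
have b_gt0 i : 0 < b i.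
  by rewrite subr_gt0 ltr_pdivrMr// ltr_pMr// ltr1n.
have b_lt i : b i < T by rewrite gtrBl divr_gt0.
have -> : (\int[mu]_(t in `[0%R, T]) w t = \int[mu]_(t in `[0%R, T[) w t)%E.
  rewrite integral_itv_bndo_bndc//; exact: mw.
have -> : `[0, T[%classic = \bigcup_i `[0, b i]%classic.
  apply/seteqP; split => t /=; rewrite in_itv/=.
    move=> /andP[t0 tT]; exists (Num.bound (T / (T - t))) => //=.
    rewrite in_itv/= t0/= /b; set N := Num.bound _.
    have TN : T / (T - t) < N%:R.
      by rewrite archi_boundP// divr_ge0// ltW// subr_gt0.
    rewrite lerBrDr -lerBrDl ler_pdivrMr//.
    rewrite ltr_pdivrMr ?subr_gt0// in TN.
    apply: (le_trans (ltW TN)).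
    by rewrite mulrC ler_wpM2l ?subr_ge0 ?(ltW tT)// ler_nat -addn2 leq_addr.
  move=> [i _] /=; rewrite in_itv/= => /andP[-> ti]/=.
  exact: le_lt_trans ti _.
have nd : nondecreasing_seq (fun i => `[0, b i]%classic).
  move=> i j ij; rewrite subsetEset => t /=; rewrite !in_itv/= => /andP[-> ti]/=.
  apply: (le_trans ti); rewrite lerD2l lerN2 ler_pM2l// lef_pV2 ?posrE//.
  by rewrite ler_nat.
have cvg_int : (\int[mu]_(t in `[0%R, b i]) w t @[i --> \oo] -->
    \int[mu]_(t in \bigcup_i `[0%R, b i]%classic) w t)%E.
  by apply: ge0_nondecreasing_set_cvg_integral => // i; exact: mw.
rewrite -(cvg_lim _ cvg_int)//; apply: lime_le; first by apply/cvg_ex; eexists; exact: cvg_int.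
by near=> i; exact: integral_powR_subl_le.
Unshelve. all: by end_near. Qed.

Lemma norm_Rintegral_weight_le (d : measure_display) (T : measurableType d)
    (mu : {measure set T -> \bar R}) (D : set T) (w h : T -> R) (B : R) :
  measurable D -> mu.-integrable D (EFin \o w) -> (forall t, D t -> 0 <= w t) ->
  measurable_fun D h -> (forall t, D t -> `|h t| <= B) ->
  `|\int[mu]_(t in D) (w t * h t)| <= B * \int[mu]_(t in D) w t.
Proof.
move=> mD iw w0 mh hB.
have iBw : mu.-integrable D (EFin \o (fun t => B * w t)).
  rewrite /comp; under eq_fun do rewrite EFinM.
  exact: integrableZl.
have whB t : D t -> `|w t * h t| <= B * w t.
  by move=> Dt; rewrite normrM ger0_norm ?w0// mulrC ler_wpM2r ?w0 ?hB.
have mw : measurable_fun D w.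
  by apply/measurable_EFinP; case/integrableP : iw.
have iwh : mu.-integrable D (EFin \o (fun t => w t * h t)).
  apply: le_integrable iBw => //.
    by apply/measurable_EFinP; exact: measurable_funM.
  move=> t Dt /=; rewrite lee_fin; apply: (le_trans (whB t Dt)).
  exact: ler_norm.
apply: le_trans; first exact: (le_normr_Rintegral mD iwh).
rewrite -RintegralZl//; apply: le_Rintegral => //.
exact: integrable_norm.
Qed.

End Weight.

(** * The canonical map *)

Section CanonicalMap.
Context {R : realType} {n d : nat}.
Implicit Types (g : 'rV[R]_n -> R) (gamma : signal d 'rV[R]_n).

Lemma canonical_map_is_linear : linear (@canonical_map R n d).
Proof.
move=> a g h; apply/funext => gamma; apply/funext => t.
rewrite /canonical_map !fctE; case: ifP => _ //.
by rewrite scaler0 addr0.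
Qed.

HB.instance Definition _ := GRing.isLinear.Build R _ _ _
  (@canonical_map R n d) canonical_map_is_linear.

Definition cst_signal_fun (x : 'rV[R]_n) : R -> 'rV[R]_n :=
  fun t => if t \in `[0, 1] then x else 0.

Lemma Ck_cst_signal_fun x : Ck_on d 1 (cst_signal_fun x).
Proof.
by apply: eq_Ck_on (Ck_on_cst d 1 x) => t tT; rewrite /cst_signal_fun tT.
Qed.

Lemma cst_signal_fun_out x t : t \notin `[0, 1] -> cst_signal_fun x t = 0.
Proof. by rewrite /cst_signal_fun => /negbTE ->. Qed.

Definition cst_signal x : signal d 'rV[R]_n :=
  Signal ltr01 (Ck_cst_signal_fun x) (@cst_signal_fun_out x).

(** Constant signals, evaluated at time 0, reach every point of the space. *)
Lemma canonical_map_inj : injective (@canonical_map R n d).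
Proof.
move=> g h gh; apply/funext => x.
have := congr1 (fun phi => phi (cst_signal x) 0) gh.
have in01 : (0 : R) \in `[0, 1] by rewrite in_itv/= lexx ler01.
by rewrite /canonical_map /= /cst_signal_fun in01.
Qed.

Lemma Ck_on_canonical_map k g gamma : infinitely_differentiable g ->
  (k <= d)%N -> Ck_on k (dur gamma) (canonical_map g gamma).
Proof.
move=> sg kd; have kf := Ck_on_le kd (sig_Ck gamma).
by apply: eq_Ck_on (Ck_on_comp sg kf) => t tT; rewrite /canonical_map tT.
Qed.

Lemma canonical_map_signal_maps e g : infinitely_differentiable g ->
  (e <= d)%N -> @signal_maps R n d e (canonical_map g).
Proof.
move=> sg ed gamma.
have out t : t \notin `[0, dur gamma] -> canonical_map g gamma t = 0.
  by rewrite /canonical_map => /negbTE ->.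
by exists (Signal (dur_gt0 gamma) (Ck_on_canonical_map gamma sg ed) out).
Qed.

(** Uniform boundedness applied to the kernel sections [k (gamma t)]: for a fixed
    [u] their pairings with [u] are the values of [u \o gamma], which is
    continuous on the compact interval [[0, dur gamma]]. *)
Lemma rkhs_eval_uniform_bound (H : set ('rV[R]_n -> R)) ip gamma
    (k : 'rV[R]_n -> 'rV[R]_n -> R) :
  hilbert_space H ip -> (forall g, H g -> infinitely_differentiable g) ->
  (forall x, H (k x) /\ forall g, H g -> ip g (k x) = g x) ->
  exists M, forall g, H g -> forall t, t \in `[0, dur gamma] ->
    `|g (gamma t)| <= M * ip_norm ip g.
Proof.
move=> hH sH kP.
pose A := [set k (gamma t) | t in `[0, dur gamma]%classic].
have AH : A `<=` H by move=> _ [t _ <-]; exact: (kP _).1.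
have [|M MP] := weakly_bounded_norm_bounded hH AH.
  move=> u Hu; have cu := Ck_on_comp (sH _ Hu) (Ck_on_le (leq0n d) (sig_Ck gamma)).
  have T0 := ltW (dur_gt0 gamma).
  (* The maximum bounds the positive values, the minimum the negative ones. *)
  have [c _ cP] := EVT_max T0 cu; have [c' _ cP'] := EVT_min T0 cu.
  exists (`|u (gamma c)| + `|u (gamma c')|) => _ [t tT <-].
  rewrite (kP _).2//; have := cP t tT; have := cP' t tT => /=.
  have := ler_norm (u (gamma c)); have := ler_norm (- u (gamma c')).
  have := normr_ge0 (u (gamma c)); have := normr_ge0 (u (gamma c')).
  by rewrite ler_norml normrN; lra.
exists M => g Hg t tT; rewrite -(kP _).2//.
apply: (le_trans (cauchy_schwarz hH Hg (kP _).1)).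
by rewrite mulrC ler_wpM2r ?ip_norm_ge0//; apply: MP; exists t.
Qed.

End CanonicalMap.

Theorem theorem1 (R : realType) (n d e : nat) (hed : (e < d)%N)
    (H : set ('rV[R]_n -> R))
    (ip : ('rV[R]_n -> R) -> ('rV[R]_n -> R) -> R)
    (K : 'rV[R]_n -> 'rV[R]_n -> R)
    (hH : rkhs H ip) (hK : kernel_function H ip K)
    (hsmooth : forall g, H g -> infinitely_differentiable g) :
  set_inj H (@canonical_map R n d) /\
  forall q : R, 0 < q ->
    okhs e q (@canonical_map R n d @` H)
      (transported_ip (@canonical_map R n d) H ip).
Proof.
have injT : set_inj H (@canonical_map R n d).
  by move=> g h _ _; exact: canonical_map_inj.
split=> // q q0; have [hilb _] := hH; have [k kP _] := hK.
split.
- by move=> _ [g Hg <-]; apply: canonical_map_signal_maps (ltnW hed); exact: hsmooth.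
- exact: transported_hilbert_space injT hilb.
- move=> gamma; have [M MP] := rkhs_eval_uniform_bound gamma hilb hsmooth kP.
  set W := \int[lebesgue_measure]_(t in `[0, dur gamma]) (dur gamma - t) `^ (q - 1).
  exists (`|(Gamma q)^-1| * M * W) => _ [g Hg <-].
  rewrite /ip_norm transported_ipE// -/(ip_norm ip g) /occupation_functional.
  rewrite normrM -!mulrA ler_wpM2l// mulrCA [W * _]mulrC.
  apply: norm_Rintegral_weight_le => //.
  + exact: integrable_powR_subl q0 (dur_gt0 gamma).
  + by move=> t _; exact: powR_ge0.
  + apply: subspace_continuous_measurable_fun => //.
    exact: (Ck_on_canonical_map gamma (hsmooth _ Hg) (leq0n d)).
  + move=> t tT; rewrite /canonical_map ifT//.
    exact: MP.
Qed.
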